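(* Let $P\bowtie G$ be a Zappa-Szép product of a semigroup $P$ and a group $G$, let $\mathcal{A}$ be a unital C*-algebra, let $X$ be a product system over $P$ with coefficient $\mathcal{A}$, and let $(X,G,\beta)$ be a Zappa-Szép system. Let $\Psi$ be a representation of $X\bowtie G$ on a unital C*-algebra $\mathcal{B}$ and let $(\psi,U)$ be the covariant representation of $(X,G,\beta)$ corresponding to $\Psi$ under the one-to-one correspondence $\Pi$ between representations of $X\bowtie G$ and covariant representations of $(X,G,\beta)$ given by $\psi_p(x)=\Psi_{(p,e)}(x\otimes e)$ for $p\in P$, $x\in X_p$ and $U_g=\Psi_{(e,g)}(1_{\mathcal{A}}\otimes g)$ for $g\in G$, and conversely by $\Psi_{(p,g)}(x\otimes g)=\psi_p(x)U_g$ for $p\in P$, $g\in G$, $x\in X_p$. Then $\Psi$ is Cuntz-Pimsner covariant if and only if $\psi$ is Cuntz-Pimsner covariant.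
   Context: Semigroups and groups are discrete, and every semigroup has an identity, written $e$ (the identity of $G$ is also written $e$). Zappa-Szép product. One is given a left action $G\times P\to P$, $(g,p)\mapsto g\cdot p$, and a map $P\times G\to G$, $(p,g)\mapsto g|_p$, such that for all $g,h\in G$, $p,q\in P$: $e\cdot p=p$; $(gh)\cdot p=g\cdot(h\cdot p)$; $g\cdot e=e$; $g|_e=g$; $g\cdot(pq)=(g\cdot p)(g|_p\cdot q)$; $g|_{pq}=(g|_p)|_q$; $e|_p=e$; $(gh)|_p=g|_{h\cdot p}\,h|_p$. Then $P\bowtie G=P\times G$ with product $(p,g)(q,h)=(p(g\cdot q),\,g|_q h)$ is a semigroup with identity $(e,e)$. Product system. An $\mathcal{A}$-correspondence is a right Hilbert $\mathcal{A}$-module with a left action of $\mathcal{A}$ by adjointable operators. A product system over a semigroup $P$ with coefficient $\mathcal{A}$ is $X=\bigsqcup_{p\in P}X_p$, with each $X_p$ an $\mathcal{A}$-correspondence, with an associative multiplication $X_p\times X_q\to X_{pq}$ such that (1) $X_e=\mathcal{A}$ as an $\mathcal{A}$-correspondence; (2) for all $p,q\in P$ the multiplication extends to a unitary $M_{p,q}:X_p\otimes X_q\to X_{pq}$ (interior tensor product over $\mathcal{A}$); (3) the left and right actions of $\mathcal{A}$ on $X_p$ coincide with the multiplications $X_e\times X_p\to X_p$ and $X_p\times X_e\to X_p$. Zappa-Szép action of $G$ on $X$: a collection $\beta=\{\beta_g\}_{g\in G}$ of maps on $X$ such that (A1) for each $p\in P$, $g\in G$, $\beta_g$ restricts to a $\mathbb{C}$-linear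 map $X_p\to X_{g\cdot p}$; (A2) $\beta_g\circ\beta_h=\beta_{gh}$; (A3) $\beta_e$ is the identity; (A4) each $\beta_g$ is a $*$-automorphism of $X_e=\mathcal{A}$; (A5) $\beta_g(xy)=\beta_g(x)\beta_{g|_p}(y)$ for $x\in X_p$, $y\in X_q$; (A6) $\langle\beta_g(x),\beta_g(y)\rangle=\beta_{g|_p}(\langle x,y\rangle)$ for $x,y\in X_p$. The triple $(X,G,\beta)$ is then called a Zappa-Szép system. The product system $X\bowtie G$ over $P\bowtie G$ with coefficient $\mathcal{A}$: its fibre over $(p,g)$ is $Y_{(p,g)}=\{x\otimes g:x\in X_p\}$ with $a(x\otimes g)=ax\otimes g$, $(x\otimes g)a=x\beta_g(a)\otimes g$, $\langle x\otimes g,y\otimes g\rangle=\beta_{g^{-1}}(\langle x,y\rangle)$, and multiplication $(x\otimes g)(y\otimes h)=x\beta_g(y)\otimes g|_q h$ for $x\in X_p$, $y\in X_q$; $Y_{(e,e)}$ is identified with $\mathcal{A}$ via $a\otimes e\leftrightarrow a$. A (Toeplitz) representation of a product system $X$ over $P$ on a C*-algebra $\mathcal{B}$ is a family $\psi=(\psi_p)_{p\in P}$ of linear maps $\psi_p:X_p\to\mathcal{B}$ such that $\psi_e$ is a $*$-homomorphism, $\psi_p(x)\psi_q(y)=\psi_{pq}(xy)$ for $x\in X_p,y\in X_q$, and $\psi_p(x)^*\psi_p(y)=\psi_e(\langle x,y\rangle)$ for $x,y\in X_p$. A covariant representation of $(X,G,\beta)$ on a unital C*-algebra $\mathcal{B}$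 is a pair $(\psi,U)$ of a representation $\psi$ of $X$ on $\mathcal{B}$ and a unitary representation $U$ of $G$ on $\mathcal{B}$ with $U_g\psi_p(x)=\psi_{g\cdot p}(\beta_g(x))U_{g|_p}$ for all $p\in P$, $g\in G$, $x\in X_p$. Cuntz-Pimsner covariance. $\mathcal{L}(X_p)$ is the C*-algebra of adjointable operators, $\theta_{x,y}(z)=x\langle y,z\rangle$, and $\mathcal{K}(X_p)$ is the C*-subalgebra of $\mathcal{L}(X_p)$ generated by the $\theta_{x,y}$, $x,y\in X_p$. A representation $\psi$ induces homomorphisms $\psi^{(p)}:\mathcal{K}(X_p)\to\mathcal{B}$ with $\psi^{(p)}(\theta_{x,y})=\psi_p(x)\psi_p(y)^*$. Let $\phi_p:X_e\to\mathcal{L}(X_p)$, $\phi_p(a)x=a\cdot x$. The representation $\psi$ is Cuntz-Pimsner covariant if $\psi^{(p)}(\phi_p(a))=\psi_e(a)$ for all $p\in P$ and all $a\in X_e$ with $\phi_p(a)\in\mathcal{K}(X_p)$. The same definition applies to $\Psi$ and the product system $X\bowtie G$ over $P\bowtie G$. *)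

(* Defs.v *)
From HB Require Import structures.
From mathcomp Require Import all_boot all_order all_algebra.
From mathcomp Require Import complex.
From mathcomp Require Import all_classical all_reals.

Set Implicit Arguments.
Unset Strict Implicit.
Unset Printing Implicit Defensive.

Import Order.TTheory GRing.Theory Num.Theory.

Local Open Scope classical_set_scope.
Local Open Scope ring_scope.
Local Open Scope complex_scope.

(* As in any [algType], 1 != 0.  Nonnegativity of [csnorm] follows from
   [csnormD] and [csnormZ]. *)
HB.mixin Record isCStarAlgebra (R : realType) A of GRing.Algebra R[i] A := {
  star : A -> A ;
  csnorm : A -> R ;
  starK : forall a, star (star a) = a ;
  starD : forall a b, star (a + b) = star a + star b ;
  starZ : forall (c : R[i]) a, star (c *: a) = c^* *: star a ;
  starM : forall a b, star (a * b) = star b * star a ;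
  csnorm_eq0 : forall a, csnorm a = 0 -> a = 0 ;
  csnormD : forall a b, csnorm (a + b) <= csnorm a + csnorm b ;
  csnormZ : forall (c : R[i]) a, csnorm (c *: a) = complex.Re `|c| * csnorm a ;
  csnormM : forall a b, csnorm (a * b) <= csnorm a * csnorm b ;
  csnorm_star : forall a, csnorm (star a * a) = csnorm a ^+ 2 ;
  cs_complete : forall u : nat -> A,
    (forall e : R, 0 < e -> exists N : nat, forall m n : nat,
       (N <= m)%N -> (N <= n)%N -> csnorm (u m - u n) < e) ->
    exists l : A, forall e : R, 0 < e -> exists N : nat, forall n : nat,
       (N <= n)%N -> csnorm (u n - l) < e
}.

#[short(type="unitalCStarType")]
HB.structure Definition UnitalCStarAlgebra (R : realType) :=
  {A of GRing.Algebra R[i] A & isCStarAlgebra R A}.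

Arguments star {R s} _.
Arguments csnorm {R s} _.

Definition cs_positive (R : realType) (A : unitalCStarType R) (a : A) : Prop :=
  exists b : A, a = star b * b.

Definition star_morphism (R : realType) (A B : unitalCStarType R)
    (f : A -> B) : Prop :=
  [/\ forall a b, f (a + b) = f a + f b,
      forall (c : R[i]) a, f (c *: a) = c *: f a,
      forall a b, f (a * b) = f a * f b
    & forall a, f (star a) = star (f a)].

(* Operations only; the axioms are in [is_hilbert_module] and
   [is_correspondence].  [lact a x] is a.x, [ract x a] is x.a, and [inner x y]
   is <x, y>, conjugate linear in x. *)
Record correspondence (R : realType) (A : unitalCStarType R) := Correspondence {
  carrier :> lmodType R[i] ;
  lact : A -> carrier -> carrier ;
  ract : carrier -> A -> carrier ;
  inner : carrier -> carrier -> A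
}.

Section Modules.
Context (R : realType) (A : unitalCStarType R).

Definition hnorm (E : correspondence A) (x : E) : R := Num.sqrt (csnorm (inner x x)).

Record is_hilbert_module (E : correspondence A) : Prop := {
  ractDl : forall (x y : E) a, ract (x + y) a = ract x a + ract y a ;
  ractDr : forall (x : E) a b, ract x (a + b) = ract x a + ract x b ;
  ractZl : forall (c : R[i]) (x : E) a, ract (c *: x) a = c *: ract x a ;
  ractZr : forall (c : R[i]) (x : E) a, ract x (c *: a) = c *: ract x a ;
  ractM : forall (x : E) a b, ract x (a * b) = ract (ract x a) b ;
  ract1 : forall x : E, ract x 1 = x ;
  innerDr : forall x y z : E, inner x (y + z) = inner x y + inner x z ;
  innerZr : forall (c : R[i]) (x y : E), inner x (c *: y) = c *: inner x y ;
  inner_ract : forall (x y : E) a, inner x (ract y a) = inner x y * a ;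
  inner_star : forall x y : E, star (inner x y) = inner y x ;
  inner_ge0 : forall x : E, cs_positive (inner x x) ;
  inner_eq0 : forall x : E, inner x x = 0 -> x = 0 ;
  hilbert_complete : forall u : nat -> E,
    (forall e : R, 0 < e -> exists N : nat, forall m n : nat,
       (N <= m)%N -> (N <= n)%N -> hnorm (u m - u n) < e) ->
    exists l : E, forall e : R, 0 < e -> exists N : nat, forall n : nat,
       (N <= n)%N -> hnorm (u n - l) < e
}.

Definition adjoint_pair (E F : correspondence A) (T : E -> F) (S : F -> E) :
    Prop :=
  forall x y, inner (T x) y = inner x (S y).

(* L(E) *)
Definition adjointable (E : correspondence A) : set (E -> E) :=
  [set T | exists S, adjoint_pair T S].

Definition unitary_map (E F : correspondence A) (M : E -> F) : Prop :=
  exists V : F -> E, [/\ adjoint_pair M V, cancel M V & cancel V M].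

(* Linearity of [lact a] in the module variable follows from
   [lact_adjoint]. *)
Record is_correspondence (E : correspondence A) : Prop := {
  corr_hilbert : is_hilbert_module E ;
  lactDl : forall a b (x : E), lact (a + b) x = lact a x + lact b x ;
  lactZl : forall (c : R[i]) a (x : E), lact (c *: a) x = c *: lact a x ;
  lactM : forall a b (x : E), lact (a * b) x = lact a (lact b x) ;
  lact_adjoint : forall a, adjoint_pair (@lact _ _ E a) (lact (star a))
}.

(* (T, tau) is the interior tensor product of E and F over A: the completion of
   the algebraic tensor product for the semi-inner product
   <x (x) y, x' (x) y'> = <y, <x, x'> y'>, with tau x y = x (x) y. *)
Record is_interior_tensor (E F T : correspondence A) (tau : E -> F -> T) :
    Prop := {
  tens_corr : is_correspondence T ;
  tensDl : forall x x' y, tau (x + x') y = tau x y + tau x' y ;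
  tensDr : forall x y y', tau x (y + y') = tau x y + tau x y' ;
  tensZl : forall (c : R[i]) x y, tau (c *: x) y = c *: tau x y ;
  tensZr : forall (c : R[i]) x y, tau x (c *: y) = c *: tau x y ;
  tens_balanced : forall x a y, tau (ract x a) y = tau x (lact a y) ;
  tens_ract : forall x y a, ract (tau x y) a = tau x (ract y a) ;
  tens_lact : forall a x y, lact a (tau x y) = tau (lact a x) y ;
  tens_inner : forall x y x' y',
    inner (tau x y) (tau x' y') = inner y (lact (inner x x') y') ;
  tens_dense : forall (t : T) (e : R), 0 < e ->
    exists s : seq (E * F), hnorm (t - \sum_(z <- s) tau z.1 z.2) < e
}.

(* The operator norm of T is at most c. *)
Definition opnorm_le (E : correspondence A) (T : E -> E) (c : R) : Prop :=
  forall x, hnorm (T x) <= c * hnorm x.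

Record cstar_subalgebra (E : correspondence A) (M : set (E -> E)) : Prop := {
  sub_adjointable : M `<=` @adjointable E ;
  sub0 : M (fun=> 0) ;
  subD : forall S T, M S -> M T -> M (S \+ T) ;
  subZ : forall (c : R[i]) T, M T -> M (c \*: T) ;
  subM : forall S T, M S -> M T -> M (S \o T) ;
  sub_adj : forall S T, M S -> adjoint_pair S T -> M T ;
  sub_closed : forall T, adjointable T ->
    (forall e : R, 0 < e -> exists2 S, M S & opnorm_le (T \- S) e) -> M T
}.

Definition theta (E : correspondence A) (x y : E) : E -> E :=
  fun z => ract x (inner y z).

(* K(E) *)
Definition compact_op (E : correspondence A) : set (E -> E) :=
  smallest (@cstar_subalgebra E) [set T | exists x y : E, T = theta x y].

End Modules.

(* Operations only; the axioms are in [is_product_system].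
   [unit_in] and [unit_out] are the two directions of the identification of the
   fibre over the identity with A. *)
Record prodsys (R : realType) (A : unitalCStarType R) (P : monoidType) :=
  ProdSys {
    fibre :> P -> correspondence A ;
    psmul : forall p q, fibre p -> fibre q -> fibre (p * q)%g ;
    unit_in : A -> fibre 1%g ;
    unit_out : fibre 1%g -> A
  }.

Arguments psmul {R A P} X {p q} x y : rename.
Arguments unit_in {R A P} X a : rename.
Arguments unit_out {R A P} X x : rename.

(* [elt x] is x as an element of the disjoint union of the fibres; equality of
   such elements compares members of fibres over provably equal indices. *)
Definition elt (R : realType) (A : unitalCStarType R) (P : monoidType)
    (X : prodsys A P) (p : P) (x : X p) : {q : P & X q} :=
  existT (fun q : P => X q : Type) p x.

Record is_product_system (R : realType) (A : unitalCStarType R)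
    (P : monoidType) (X : prodsys A P) : Prop := {
  ps_corr : forall p, is_correspondence (X p) ;
  ps_mulA : forall p q r (x : X p) (y : X q) (z : X r),
    elt (psmul X (psmul X x y) z) = elt (psmul X x (psmul X y z)) ;
  unit_inK : cancel (unit_in X) (unit_out X) ;
  unit_outK : cancel (unit_out X) (unit_in X) ;
  unit_inD : forall a b, unit_in X (a + b) = unit_in X a + unit_in X b ;
  unit_inZ : forall (c : R[i]) a, unit_in X (c *: a) = c *: unit_in X a ;
  unit_in_lact : forall a b, lact a (unit_in X b) = unit_in X (a * b) ;
  unit_in_ract : forall a b, ract (unit_in X b) a = unit_in X (b * a) ;
  unit_in_inner : forall a b, inner (unit_in X a) (unit_in X b) = star a * b ;
  ps_unitary : forall p q,
    exists (T : correspondence A) (tau : X p -> X q -> T) (M : T -> X (p * q)%g),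
      [/\ is_interior_tensor tau, unitary_map M
        & forall x y, M (tau x y) = psmul X x y] ;
  ps_lact : forall p a (x : X p), elt (lact a x) = elt (psmul X (unit_in X a) x) ;
  ps_ract : forall p (x : X p) a, elt (ract x a) = elt (psmul X x (unit_in X a))
}.

(* [zact g p] is g . p and [zres p g] is g|_p. *)
Record zappa_szep (P : monoidType) (G : groupType) := ZappaSzep {
  zact : G -> P -> P ;
  zres : P -> G -> G ;
  zact1g : forall p, zact 1%g p = p ;
  zactMg : forall g h p, zact (g * h)%g p = zact g (zact h p) ;
  zactg1 : forall g, zact g 1%g = 1%g ;
  zres1 : forall g, zres 1%g g = g ;
  zactgM : forall g p q, zact g (p * q)%g = (zact g p * zact (zres p g) q)%g ;
  zresM : forall g p q, zres (p * q)%g g = zres q (zres p g) ;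
  zres1g : forall p, zres p 1%g = 1%g ;
  zresMg : forall g h p, zres p (g * h)%g = (zres (zact h p) g * zres p h)%g
}.

(* An alias, to keep the componentwise product of P * G out of the way. *)
Definition zsprod (P : monoidType) (G : groupType) (Z : zappa_szep P G) : Type :=
  (P * G)%type.

Section ZappaSzepMonoid.
Context (P : monoidType) (G : groupType) (Z : zappa_szep P G).

Definition zsmul (u v : zsprod Z) : zsprod Z :=
  ((u.1 * zact Z u.2 v.1)%g, (zres Z v.1 u.2 * v.2)%g).

Definition zsone : zsprod Z := (1%g, 1%g).

Lemma zsmulA : associative zsmul.
Proof.
move=> [p g] [q h] [r k]; rewrite /zsmul /=; congr pair.
  by rewrite zactgM zactMg mulgA.
by rewrite zresM zresMg mulgA.
Qed.

Lemma zsmul1 : left_id zsone zsmul.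
Proof. by move=> [p g]; rewrite /zsmul /= zact1g zres1g !mul1g. Qed.

Lemma zsmulr1 : right_id zsone zsmul.
Proof. by move=> [p g]; rewrite /zsmul /= zactg1 zres1 !mulg1. Qed.

HB.instance Definition _ := Choice.copy (zsprod Z) (P * G)%type.
HB.instance Definition _ := isMonoid.Build (zsprod Z) zsmulA zsmul1 zsmulr1.

End ZappaSzepMonoid.

Section ZappaSzepSystem.
Context (R : realType) (A : unitalCStarType R) (P : monoidType) (G : groupType).
Context (Z : zappa_szep P G) (X : prodsys A P).

Definition zsmaps := forall (g : G) (p : P), X p -> X (zact Z g p).

(* beta_g on the fibre over the identity, seen as a map on A. *)
Definition coef_act (beta : zsmaps) (g : G) (a : A) : A :=
  unit_out X (ecast p (X p) (zactg1 Z g) (beta g 1%g (unit_in X a))).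

Record is_zappa_szep_action (beta : zsmaps) : Prop := {
  zsbetaD : forall g p (x y : X p), beta g p (x + y) = beta g p x + beta g p y ;
  zsbetaZ : forall g p (c : R[i]) (x : X p),
    beta g p (c *: x) = c *: beta g p x ;
  zsbetaM : forall g h p (x : X p),
    elt (beta g (zact Z h p) (beta h p x)) = elt (beta (g * h)%g p x) ;
  zsbeta1 : forall p (x : X p), elt (beta 1%g p x) = elt x ;
  zsbeta_bij : forall g, bijective (coef_act beta g) ;
  zsbeta_star : forall g, star_morphism (coef_act beta g) ;
  zsbeta_mul : forall g p q (x : X p) (y : X q),
    elt (beta g (p * q)%g (psmul X x y))
    = elt (psmul X (beta g p x) (beta (zres Z p g) q y)) ;
  zsbeta_inner : forall g p (x y : X p),
    inner (beta g p x) (beta g p y) = coef_act beta (zres Z p g) (inner x y)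
}.

(* The element x (x) g of the fibre over (p, g) is represented by x. *)
Definition zsfibre (beta : zsmaps) (u : zsprod Z) : correspondence A :=
  Correspondence
    (fun (a : A) (x : X u.1) => lact a x)
    (fun (x : X u.1) (a : A) => ract x (coef_act beta u.2 a))
    (fun x y : X u.1 => coef_act beta (u.2)^-1%g (inner x y)).

Definition zsprodsys (beta : zsmaps) : prodsys A (zsprod Z) :=
  @ProdSys R A (zsprod Z) (zsfibre beta)
    (fun u v (x : X u.1) (y : X v.1) => psmul X x (beta u.2 v.1 y))
    (unit_in X) (unit_out X).

Definition zstens (beta : zsmaps) (p : P) (x : X p) (g : G) :
  zsprodsys beta (p, g) := x.

End ZappaSzepSystem.

Section Representations.
Context (R : realType) (A : unitalCStarType R) (P : monoidType).
Context (X : prodsys A P) (B : unitalCStarType R).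

Definition repmaps := forall p : P, X p -> B.

Record is_representation (psi : repmaps) : Prop := {
  repD : forall p (x y : X p), psi p (x + y) = psi p x + psi p y ;
  repZ : forall p (c : R[i]) (x : X p), psi p (c *: x) = c *: psi p x ;
  rep_unit : star_morphism (fun a : A => psi 1%g (unit_in X a)) ;
  repM : forall p q (x : X p) (y : X q),
    psi p x * psi q y = psi (p * q)%g (psmul X x y) ;
  rep_inner : forall p (x y : X p),
    star (psi p x) * psi p y = psi 1%g (unit_in X (inner x y))
}.

(* f, restricted to K(X_p), is the *-homomorphism psi^(p) from K(X_p) to B
   induced by psi; values of f outside K(X_p) are irrelevant. *)
Record induced_hom (psi : repmaps) (p : P) (f : (X p -> X p) -> B) : Prop := {
  indD : forall S T, compact_op S -> compact_op T -> f (S \+ T) = f S + f T ;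
  indZ : forall (c : R[i]) T, compact_op T -> f (c \*: T) = c *: f T ;
  indM : forall S T, compact_op S -> compact_op T -> f (S \o T) = f S * f T ;
  ind_star : forall S T, compact_op S -> adjoint_pair S T -> f T = star (f S) ;
  ind_theta : forall x y : X p, f (theta x y) = psi p x * star (psi p y)
}.

(* For a representation psi, psi^(p) always exists, and it is unique on K(X_p)
   since *-homomorphisms of C*-algebras are continuous; the existential
   quantifier only names it. *)
Definition cuntz_pimsner_covariant (psi : repmaps) : Prop :=
  forall p, exists2 f : (X p -> X p) -> B, induced_hom psi f &
    forall a : A, compact_op (@lact _ _ (X p) a) ->
      f (lact a) = psi 1%g (unit_in X a).

End Representations.

Arguments repmaps {R A P} X B.

Definition unitary_representation (R : realType) (G : groupType)
    (B : unitalCStarType R) (U : G -> B) : Prop :=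
  [/\ U 1%g = 1,
      forall g h, U (g * h)%g = U g * U h,
      forall g, star (U g) * U g = 1
    & forall g, U g * star (U g) = 1].

Record is_covariant_representation (R : realType) (A : unitalCStarType R)
    (P : monoidType) (G : groupType) (Z : zappa_szep P G) (X : prodsys A P)
    (beta : zsmaps Z X) (B : unitalCStarType R)
    (psi : repmaps X B) (U : G -> B) : Prop := {
  cov_rep : is_representation psi ;
  cov_unitary : unitary_representation U ;
  cov_rel : forall p g (x : X p),
    U g * psi p x = psi (zact Z g p) (beta g p x) * U (zres Z p g)
}.

(* (psi, U) is the image of Psi under Pi. *)
Definition corresponds (R : realType) (A : unitalCStarType R)
    (P : monoidType) (G : groupType) (Z : zappa_szep P G) (X : prodsys A P)
    (beta : zsmaps Z X) (B : unitalCStarType R)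
    (Psi : repmaps (zsprodsys beta) B) (psi : repmaps X B) (U : G -> B) : Prop :=
  (forall p (x : X p), psi p x = Psi (p, 1%g) (zstens beta x 1%g)) /\
  (forall g, U g = Psi (1%g, g) (zstens beta (unit_in X 1) g)).

(* Main.v *)
(* The fibre of X >< G over (p, g) is X_p with the inner product twisted by the
   *-automorphism beta_(g^-1) of A, so the two modules have the same rank-one
   operators and the same adjoints.  A *-automorphism of a C*-algebra is
   isometric, so they also have the same operator norms, hence the same compact
   operators.  Since Psi_(p,g)(x (x) g) = psi_p(x) U_g with U_g unitary,
   Psi(x) Psi(y)^* = psi(x) psi(y)^*: a homomorphism on the compact operators is
   induced by Psi on the fibre over (p, g) iff it is induced by psi on X_p.
   Contractivity of *-homomorphisms needs no spectral theory: a self-adjoint h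
   with |h| < 1 is the mean of a unitary and its adjoint, and unitaries are
   mapped to unitaries, which have norm 1. *)
Require Import Defs.
From mathcomp Require Import all_boot all_order all_algebra.
From mathcomp Require Import complex ring lra.
From mathcomp Require Import all_classical all_reals.
From mathcomp Require Import topology normedtype sequences.

Set Implicit Arguments.
Unset Strict Implicit.
Unset Printing Implicit Defensive.

Import Order.TTheory GRing.Theory Num.Theory numFieldNormedType.Exports.

(** * Norm estimates and unitaries in a unital C*-algebra *)

Section CStarNorm.
Local Open Scope ring_scope.
Local Open Scope complex_scope.
Context (R : realType) (A : unitalCStarType R).
Implicit Types (a b h y z : A).

Lemma csnormN a : csnorm (- a) = csnorm a.
Proof. by rewrite -scaleN1r csnormZ normrN1 mul1r. Qed.

Lemma csnorm0 : csnorm (0 : A) = 0.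
Proof. by rewrite -(scale0r (0 : A)) csnormZ normr0 mul0r. Qed.

Lemma csnorm_ge0 a : 0 <= csnorm a.
Proof.
have := csnormD a (- a); rewrite subrr csnorm0 csnormN; lra.
Qed.

Lemma csnormB_sym a b : csnorm (a - b) = csnorm (b - a).
Proof. by rewrite -csnormN opprB. Qed.

Lemma csnorm_triangle b a c : csnorm (a - c) <= csnorm (a - b) + csnorm (b - c).
Proof. by have := csnormD (a - b) (b - c); rewrite addrA subrK. Qed.

Lemma csnorm_real (t : R) a : 0 <= t -> csnorm (t%:C *: a) = t * csnorm a.
Proof.
by move=> t0; rewrite csnormZ normc_def /= expr0n addr0 sqrtr_sqr ger0_norm.
Qed.

Lemma star0 : star (0 : A) = 0.
Proof. by apply: (addrI (star 0)); rewrite -starD !addr0. Qed.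

Lemma starN a : star (- a) = - star a.
Proof. by apply: (addrI (star a)); rewrite -starD !subrr star0. Qed.

Lemma star1 : star (1 : A) = 1.
Proof. by rewrite -[LHS]mulr1 -{2}(starK 1) -starM mulr1 starK. Qed.

(** The C*-identity and submultiplicativity give |b|^2 <= |b^*| |b|; cancel |b| and use this for
    both a and a^*. *)
Lemma csnorm_starE a : csnorm (star a) = csnorm a.
Proof.
suff le b : csnorm b <= csnorm (star b).
  by apply/le_anti; rewrite le -{2}(starK a) le.
have := csnormM (star b) b; rewrite csnorm_star expr2.
have [->|b0] := eqVneq (csnorm b) 0; first by rewrite csnorm_ge0.
by rewrite ler_pM2r // lt_def b0 csnorm_ge0.
Qed.

Lemma star_scale_real (t : R) a : star (t%:C *: a) = t%:C *: star a.
Proof. by rewrite starZ; congr (_ *: _); apply: conjc_real. Qed.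

Lemma star_scale_i a : star ('i%C *: a) = - ('i%C *: star a).
Proof.
rewrite starZ -scaleNr; congr (_ *: _).
by apply/eqP; rewrite eq_complex /= oppr0 !eqxx.
Qed.

Lemma csnorm1 : csnorm (1 : A) = 1.
Proof.
have := csnorm_star (1 : A); rewrite star1 mulr1 expr2.
have [/csnorm_eq0/eqP|n0 /esym/eqP] := eqVneq (csnorm (1 : A)) 0.
  by rewrite oner_eq0.
rewrite -subr_eq0 -{3}[csnorm 1]mulr1 -mulrBr mulf_eq0 (negbTE n0) subr_eq0.
by move/eqP.
Qed.

(** Banach's fixed point argument, iterating from 0; [S] is a closed invariant set, since [F] need
    only contract there. *)
Lemma contraction_fixpoint (F : A -> A) (S : A -> Prop) (q : R) :
  0 <= q < 1 -> S 0 -> (forall y, S y -> S (F y)) ->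
  (forall y z, S y -> S z -> csnorm (F y - F z) <= q * csnorm (y - z)) ->
  (forall y, (forall e : R, 0 < e -> exists2 z, S z & csnorm (y - z) < e) ->
    S y) ->
  exists2 y, S y & F y = y.
Proof.
move=> /andP[q0 q1] S0 SF Fq Sc; pose u n := iter n F 0.
have Su n : S (u n) by elim: n => [|n IH] //; apply: SF.
(* [C] solves C = q C + |F 0|, so the bound |u n| <= C is preserved by each iteration. *)
pose C := csnorm (F 0) / (1 - q).
have C0 : 0 <= C by rewrite divr_ge0 ?csnorm_ge0 // subr_ge0 ltW.
have bnd n : csnorm (u n) <= C.
  elim: n => [|n IH]; first by rewrite csnorm0.
  have := csnormD (u n.+1 - F 0) (F 0); rewrite subrK => /le_trans; apply.
  have -> : C = q * C + csnorm (F 0) by rewrite /C; field; lra.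
  rewrite lerD2r; apply: le_trans (Fq _ _ (Su n) S0) _.
  by rewrite subr0 ler_wpM2l.
have geo n m : csnorm (u (n + m)%N - u n) <= q ^+ n * C.
  elim: n => [|n IH]; first by rewrite subr0 mul1r.
  apply: le_trans (Fq _ _ (Su _) (Su _)) _.
  by rewrite exprS -mulrA ler_wpM2l.
have small e : 0 < e -> exists N, forall n, (N <= n)%N -> q ^+ n * C < e.
  move=> e0; have C1 : 0 < C + 1 by lra.
  have /cvgr0_norm_lt lim : (q ^+ n @[n --> \oo] --> 0)%classic.
    by apply: cvg_expr; rewrite ger0_norm.
  have [N _ hN] := lim (e / (C + 1)) (divr_gt0 e0 C1).
  exists N => n /hN /=; rewrite ger0_norm ?exprn_ge0 // ltr_pdivlMr // => lt.
  apply: le_lt_trans lt; rewrite ler_wpM2l ?exprn_ge0 //; lra.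
have [y hy] : exists l : A, forall e : R, 0 < e -> exists N : nat,
    forall n : nat, (N <= n)%N -> csnorm (u n - l) < e.
  apply: cs_complete => e e0; have [N hN] := small _ e0.
  exists N => m n Nm Nn; case/orP: (leq_total n m) => nm.
    by rewrite -(subnKC nm); apply: le_lt_trans (geo _ _) (hN _ Nn).
  by rewrite csnormB_sym -(subnKC nm); apply: le_lt_trans (geo _ _) (hN _ Nm).
have Sy : S y.
  apply: Sc => e /hy[N /(_ N (leqnn N)) lt]; exists (u N) => //.
  by rewrite csnormB_sym.
exists y => //; apply/eqP; rewrite -subr_eq0; apply/eqP/csnorm_eq0/eqP.
rewrite eq_le csnorm_ge0 andbT leNgt; apply/negP => d0.
have [N hN] := hy (csnorm (F y - y) / 2) (divr_gt0 d0 (ltr0n _ 2)).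
have := csnorm_triangle (u N.+1) (F y) y.
have := hN N.+1 (leqnSn N); have := hN N (leqnn N).
have := Fq _ _ Sy (Su N); rewrite [csnorm (y - _)]csnormB_sym.
have := csnorm_ge0 (u N - y); rewrite [u N.+1]/=; nra.
Qed.

(* If [|h| < 1], the iteration [y -> (h^2 + y^2) / 2] converges to a
   self-adjoint [y] commuting with [h]; then [1 - y] is a square root of
   [1 - h^2] and [u := h + i (1 - y)] is unitary with [h = (u + u^* ) / 2]. *)
Lemma selfadjoint_mean_unitary h : star h = h -> csnorm h < 1 ->
  exists u, [/\ star u * u = 1 & h = 2^-1%:C *: (u + star u)].
Proof.
move=> hs h1; pose r := csnorm (h * h).
have h0 := csnorm_ge0 h.
have r0 : 0 <= r by apply: csnorm_ge0.
have r1 : r < 1 by apply: le_lt_trans (csnormM _ _) _; nra.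
pose F y := 2^-1%:C *: (h * h + y * y).
(* On the ball of radius [r], |y^2 - z^2| <= 2 r |y - z|, so [F] contracts by [r]; it preserves the
   ball because (r + r^2) / 2 <= r. *)
pose S y := [/\ csnorm y <= r, star y = y & h * y = y * h].
have half : 0 <= 2^-1 :> R by rewrite invr_ge0.
have [||y [y1 y2 y3]|y z [y1 _ _] [z1 _ _]|y Sy|] :=
    @contraction_fixpoint F S r; rewrite ?r0 //.
- by split; rewrite ?csnorm0 ?star0 ?mulr0 ?mul0r.
- split.
  + rewrite csnorm_real //; have := csnormD (h * h) (y * y).
    have := csnormM y y; have := csnorm_ge0 y; rewrite -/r; nra.
  + by rewrite /F star_scale_real starD !starM hs y2.
  + by rewrite /F -scalerAl -scalerAr mulrDr mulrDl !mulrA y3 -!mulrA y3.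
- rewrite /F -scalerBr csnorm_real // opprD addrACA subrr add0r.
  have -> : y * y - z * z = y * (y - z) + (y - z) * z.
    by rewrite mulrBr mulrBl addrA subrK.
  have := csnormD (y * (y - z)) ((y - z) * z).
  have := csnormM y (y - z); have := csnormM (y - z) z.
  have := csnorm_ge0 (y - z); have := csnorm_ge0 y; have := csnorm_ge0 z; nra.
(* [S] is closed: an approximant of y within e makes both y^* - y and h y - y h of norm at most 2 e,
   the latter because |h| < 1. *)
- have eqs a b (k : R) : 0 <= k ->
      (forall e, 0 < e -> csnorm (a - b) <= k * e) -> a = b.
    move=> k0 ab; apply/eqP; rewrite -subr_eq0; apply/eqP/csnorm_eq0/le_anti.
    rewrite csnorm_ge0 andbT; apply/ler_addgt0Pr => e e0; rewrite add0r.
    apply: le_trans (ab (e / (k + 1)) _) _; first by rewrite divr_gt0 //; lra.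
    by rewrite mulrA ler_pdivrMr; nra.
  split.
  + apply/ler_addgt0Pr => e /Sy[z [z1 _ _]].
    have := csnormD z (y - z); rewrite addrC subrK; lra.
  + apply: (@eqs _ _ 2) => // e /Sy[z [_ z2 _] yz].
    have := csnorm_triangle z (star y) y.
    rewrite -{1}z2 -starN -starD csnorm_starE (csnormB_sym z); lra.
  + apply: (@eqs _ _ 2) => // e /Sy[z [_ _ z3] yz].
    have := csnorm_triangle (h * z) (h * y) (y * h).
    rewrite -mulrBr z3 -mulrBl.
    have := csnormM h (y - z); have := csnormM (z - y) h.
    rewrite (csnormB_sym z); have := csnorm_ge0 (y - z); nra.
move=> y [_ y2 y3] Fy; pose b := 1 - y.
have bs : star b = b by rewrite starD star1 starN y2.
have hb : h * b = b * h by rewrite mulrBr mulrBl y3 mul1r mulr1.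
have us : star (h + 'i%C *: b) = h - 'i%C *: b.
  by rewrite starD star_scale_i hs bs.
have two (a : A) : 2^-1%:C *: (a + a) = a.
  rewrite scalerDr -scalerDl -[RHS]scale1r; congr (_ *: _).
  by apply/eqP; rewrite eq_complex /= addr0 eqxx andbT; apply/eqP; field.
exists (h + 'i%C *: b); rewrite us; split; last first.
  by rewrite addrACA subrr addr0 two.
(* The fixed point equation 2 y = h^2 + y^2 says h^2 + b^2 = 1; in u^* u the cross terms cancel
   since [h] and [b] commute. *)
have hh : h * h = y + y - y * y.
  by rewrite -{1 2}Fy -scalerDr two addrK.
have bb : b * b = 1 - (y + y - y * y).
  by rewrite /b mulrBr mulr1 mulrBl mul1r -addrA -opprD [y + (y - _)]addrA.
rewrite mulrDr !mulrBl -!scalerAr -!scalerAl scalerA [_ * 'i%C]sqr_i.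
rewrite scaleN1r opprK hb.
by rewrite addrA subrK hh bb addrC subrK.
Qed.

Lemma csnorm_unitary (u : A) : star u * u = 1 -> csnorm u = 1.
Proof.
move=> uu; have := csnorm_star u; rewrite uu csnorm1 => /esym/eqP.
by rewrite sqrf_eq1 => /orP[/eqP //|/eqP u1]; have := csnorm_ge0 u; lra.
Qed.

End CStarNorm.

(** * Contractivity of unital *-homomorphisms *)

Section StarMorphisms.
Local Open Scope ring_scope.
Local Open Scope complex_scope.
Context (R : realType) (A B : unitalCStarType R).

Lemma star_morphism_contractive (f : A -> B) : star_morphism f -> f 1 = 1 ->
  forall a, csnorm (f a) <= csnorm a.
Proof.
move=> [fD fZ fM fS] f1.
have sa1 h : star h = h -> csnorm h < 1 -> csnorm (f h) <= 1.
  move=> hs /(selfadjoint_mean_unitary hs)[u [uu ->]].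
  rewrite fZ csnorm_real ?invr_ge0 // fD fS.
  have fu : csnorm (f u) = 1 by apply: csnorm_unitary; rewrite -fS -fM uu.
  have := csnormD (f u) (star (f u)); rewrite csnorm_starE fu; lra.
have sa h : star h = h -> csnorm (f h) <= csnorm h.
  move=> hs; apply/ler_addgt0Pr => e e0; set t := csnorm h + e.
  have t0 : 0 < t by rewrite ltr_wpDl ?csnorm_ge0.
  have := sa1 (t^-1%:C *: h).
  rewrite star_scale_real hs fZ !csnorm_real ?invr_ge0 ?(ltW t0) //.
  rewrite ![t^-1 * _]mulrC ltr_pdivrMr // ler_pdivrMr // mul1r; apply=> //.
  by rewrite /t ltrDl.
move=> a; rewrite -(@ler_pXn2r _ 2) ?nnegrE ?csnorm_ge0 //.
by rewrite -!csnorm_star -fS -fM sa // starM starK.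
Qed.

End StarMorphisms.

(** * Equality across fibres with provably equal indices *)

Section Elements.
Local Open Scope ring_scope.
Context (R : realType) (A : unitalCStarType R) (P : monoidType).
Context (X : prodsys A P).

Lemma elt_inj p : injective (@elt R A P X p).
Proof. by move=> x y; apply: existT_inj2. Qed.

Lemma elt_ecast p q (e : p = q) (x : X p) : elt (ecast p (X p) e x) = elt x.
Proof. by case: q / e. Qed.

Lemma elt_psmul p q p' q' (x : X p) (y : X q) (x' : X p') (y' : X q') :
  elt x = elt x' -> elt y = elt y' -> elt (psmul X x y) = elt (psmul X x' y').
Proof.
pose m (s t : {q : P & X q}) := elt (psmul X (projT2 s) (projT2 t)).
by move=> ex ey; have := congr2 m ex ey.
Qed.

Lemma elt_psmul_unit (hX : is_product_system X) p (x : X p) :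
  elt (psmul X x (unit_in X 1)) = elt x.
Proof. by rewrite -ps_ract // (ract1 (corr_hilbert (ps_corr hX p))). Qed.

End Elements.

(** * The action of G on the coefficient algebra *)

Section CoefficientAction.
Local Open Scope ring_scope.
Context (R : realType) (A : unitalCStarType R) (P : monoidType) (G : groupType).
Context (Z : zappa_szep P G) (X : prodsys A P) (hX : is_product_system X).
Context (beta : zsmaps Z X) (hbeta : is_zappa_szep_action beta).
Arguments beta : clear implicits.

Lemma elt_beta g p q (x : X p) (y : X q) :
  elt x = elt y -> elt (beta g p x) = elt (beta g q y).
Proof.
pose m (s : {q : P & X q}) := elt (beta g (projT1 s) (projT2 s)).
by move=> e; have := congr1 m e.
Qed.

(** The cast along g . e = e is invisible to [elt]; this carries the axioms of [beta] over to
    [coef_act]. *)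
Lemma elt_coef_act g a :
  elt (unit_in X (coef_act beta g a)) = elt (beta g 1%g (unit_in X a)).
Proof. by rewrite (unit_outK hX) elt_ecast. Qed.

Lemma coef_actM g h a :
  coef_act beta g (coef_act beta h a) = coef_act beta (g * h)%g a.
Proof.
apply: (can_inj (unit_inK hX)); apply: elt_inj; rewrite !elt_coef_act.
by rewrite (elt_beta g (elt_coef_act h a)) zsbetaM.
Qed.

Lemma coef_act1 a : coef_act beta 1%g a = a.
Proof.
apply: (can_inj (unit_inK hX)); apply: elt_inj.
by rewrite elt_coef_act zsbeta1.
Qed.

Lemma coef_actK g : cancel (coef_act beta g) (coef_act beta g^-1%g).
Proof. by move=> a; rewrite coef_actM mulVg coef_act1. Qed.

Lemma coef_actVK g : cancel (coef_act beta g^-1%g) (coef_act beta g).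
Proof. by move=> a; rewrite coef_actM mulgV coef_act1. Qed.

(** A surjective multiplicative map sends 1 to a unit of its image, here all of A. *)
Lemma coef_act_unit g : coef_act beta g 1 = 1.
Proof.
have [_ _ fM _] := zsbeta_star hbeta g.
by rewrite -[LHS]mulr1 -{2}(coef_actVK g 1) -fM mul1r coef_actVK.
Qed.

(** Both the automorphism and its inverse are contractive. *)
Lemma csnorm_coef_act g a : csnorm (coef_act beta g a) = csnorm a.
Proof.
have le h b : csnorm (coef_act beta h b) <= csnorm b.
  by apply: star_morphism_contractive (zsbeta_star hbeta h) (coef_act_unit h) _.
by apply/le_anti; rewrite le -{1}(coef_actK g a) le.
Qed.

(** * Operators on the fibres of X >< G compared with those on X *)

Lemma zsfibre_hnorm (u : zsprod Z) (x : X u.1) :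
  @hnorm R A (zsfibre beta u) x = hnorm x.
Proof. by rewrite /hnorm csnorm_coef_act. Qed.

Lemma zsfibre_adjoint_pair (u : zsprod Z) (S T : X u.1 -> X u.1) :
  @adjoint_pair R A (zsfibre beta u) (zsfibre beta u) S T <-> adjoint_pair S T.
Proof.
split=> ST x y; last by rewrite /= ST.
exact: (can_inj (coef_actK _)) (ST x y).
Qed.

Lemma zsfibre_opnorm_le (u : zsprod Z) (T : X u.1 -> X u.1) c :
  @opnorm_le R A (zsfibre beta u) T c <-> opnorm_le T c.
Proof. by split=> Tc x; have := Tc x; rewrite !zsfibre_hnorm. Qed.

Lemma zsfibre_adjointable (u : zsprod Z) (T : X u.1 -> X u.1) :
  @adjointable R A (zsfibre beta u) T <-> adjointable T.
Proof. by split=> -[S /zsfibre_adjoint_pair TS]; exists S. Qed.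

(** The twist by beta_g in the right action undoes the twist by beta_(g^-1) in the inner product. *)
Lemma zsfibre_theta (u : zsprod Z) (x y : X u.1) :
  @theta R A (zsfibre beta u) x y = theta x y.
Proof. by apply/funext => z; rewrite /theta /= coef_actVK. Qed.

Lemma zsfibre_cstar_subalgebra (u : zsprod Z) (M : set (X u.1 -> X u.1)) :
  @cstar_subalgebra R A (zsfibre beta u) M <-> cstar_subalgebra M.
Proof.
split=> -[Madj M0 MD MZ MM Mstar Mcl]; (split=> //;
  [ by move=> T /Madj/zsfibre_adjointable
  | by move=> S T MS /zsfibre_adjoint_pair; apply: Mstar
  | move=> T /zsfibre_adjointable adjT MT; apply: Mcl => // e /MT[S MS Se];
    by exists S => //; apply/zsfibre_opnorm_le ]).
Qed.

Lemma zsfibre_compact_op (u : zsprod Z) :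
  @compact_op R A (zsfibre beta u) = @compact_op R A (X u.1).
Proof.
rewrite /compact_op; congr smallest.
  by apply/funext => M; apply/propext/zsfibre_cstar_subalgebra.
apply/funext => T; apply/propext; split=> -[x [y ->]]; exists x, y.
  exact: zsfibre_theta.
by rewrite zsfibre_theta.
Qed.

(** * Induced homomorphisms and the factorisation of [Psi] *)

Lemma zsfibre_induced_hom (B : unitalCStarType R)
    (Psi : repmaps (zsprodsys beta) B) (psi : repmaps X B) (u : zsprod Z)
    (f : (X u.1 -> X u.1) -> B) :
  (forall x y : X u.1,
     Psi u x * star (Psi u y) = psi u.1 x * star (psi u.1 y)) ->
  @induced_hom R A (zsprod Z) (zsprodsys beta) B Psi u f <-> induced_hom psi f.
Proof.
move=> same; split=> -[].
  rewrite zsfibre_compact_op => fD fZ fM fS fth; split=> //.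
    by move=> S T cS /zsfibre_adjoint_pair; apply: fS.
  by move=> x y; rewrite -same -fth zsfibre_theta.
move=> fD fZ fM fS fth; split; rewrite ?zsfibre_compact_op //.
  by move=> S T cS /zsfibre_adjoint_pair; apply: fS.
by move=> x y; rewrite zsfibre_theta same -fth.
Qed.

Lemma zsrep_factor (B : unitalCStarType R) (Psi : repmaps (zsprodsys beta) B)
    (hPsi : is_representation Psi) p g (x : X p) :
  Psi (p, g) (zstens beta x g) =
  Psi (p, 1%g) (zstens beta x 1%g) * Psi (1%g, g) (zstens beta (unit_in X 1) g).
Proof.
(* The product lies over an index only provably equal to (p, g). As the fibre over (q, h) has
   carrier X_q for every h, [m] allows the P-index with its element, and then the G-index, to be
   rewritten without casts. *)
pose m h (s : {q : P & X q}) := Psi (projT1 s, h) (projT2 s).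
rewrite (repM hPsi) /=.
have e : elt (psmul X x (beta 1%g 1%g (unit_in X 1))) = elt x.
  by rewrite -[RHS](elt_psmul_unit hX); apply: elt_psmul; rewrite ?zsbeta1.
have eg : (zres Z 1%g 1%g * g)%g = g by rewrite zres1g mul1g.
rewrite -[LHS]/(m g (elt x)) -e.
exact: (congr1 (fun h => m h (elt _)) (esym eg)).
Qed.

End CoefficientAction.

Theorem theorem4p8 (R : realType) (P : monoidType) (G : groupType)
    (Z : zappa_szep P G) (A : unitalCStarType R) (X : prodsys A P)
    (hX : is_product_system X)
    (beta : zsmaps Z X) (hbeta : is_zappa_szep_action beta)
    (B : unitalCStarType R) (Psi : repmaps (zsprodsys beta) B)
    (hPsi : is_representation Psi)
    (psi : repmaps X B) (U : G -> B)
    (hcov : is_covariant_representation beta psi U)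
    (hPi : corresponds Psi psi U) :
  cuntz_pimsner_covariant Psi <-> cuntz_pimsner_covariant psi.
Proof.
have [_ _ _ U1U] := cov_unitary hcov.
have [psiE UE] := hPi.
have same u x y :
    (Psi u x * star (Psi u y) = psi u.1 x * star (psi u.1 y))%R.
  case: u x y => p g x y.
  rewrite !(zsrep_factor hX hbeta hPsi (p := p) g) -!psiE -UE starM.
  by rewrite mulrA -[X in (X * _)%R]mulrA U1U mulr1.
have unit a : Psi 1%g (unit_in (zsprodsys beta) a) = psi 1%g (unit_in X a).
  by rewrite psiE.
split=> cp.
  (* For [psi] at p, the fibre over (p, e) suffices; conversely, [psi] at p serves every (p, g), as
     the left actions agree. *)
  move=> p; have [f hf fE] := cp (p, 1%g).
  exists f.
    exact/(zsfibre_induced_hom hX hbeta (u := (p, 1%g)) f (same _)).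
  by move=> a ca; rewrite -unit -fE // zsfibre_compact_op.
move=> u; have [f hf fE] := cp u.1.
exists f; first exact/(zsfibre_induced_hom hX hbeta f (same u)).
by move=> a; rewrite zsfibre_compact_op // unit => /fE.
Qed.
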